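(* For any constant $\epsilon>0$: (a) $\mathcal{G}\big(n,p=\frac{2-\epsilon}{n},2\big)$ is w.h.p. adaptably $2$-colorable. (b) $\mathcal{G}\big(n,p=\frac{2+\epsilon}{n},2\big)$ is w.h.p. not adaptably $2$-colorable.
   Context: For a finite simple graph $G=(V,E)$ with a (not necessarily proper) edge coloring $c:E\to\{red,blue\}$, a vertex coloring $\sigma:V\to\{red,blue\}$ is adapted to $c$ if for every edge $uv\in E$ either $\sigma(u)\neq c(uv)$ or $\sigma(v)\ne c(uv)$. The pair $(G,c)$ is adaptably $2$-colorable if there exists a vertex coloring adapted to $c$. $\mathcal{G}(n,p,2)$ is the random pair $(G,c)$ in which each possible edge on $n$ labelled vertices is included independently with probability $p\in[0,1]$, and each included edge is independently assigned a uniformly random color from $\{red,blue\}$. A sequence of events $A_n$ occurs w.h.p. if $\mathbb{P}[A_n]\to 1$ as $n\to\infty$. *)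

(* Defs.v *)
From mathcomp Require Import all_boot all_order all_algebra.
From mathcomp Require Import boolp classical_sets reals topology normedtype.
From mathcomp Require Import sequences.

Set Implicit Arguments.
Unset Strict Implicit.
Unset Printing Implicit Defensive.

Import Order.TTheory GRing.Theory Num.Theory.
Import numFieldNormedType.Exports.

Local Open Scope ring_scope.

Definition color : finType := bool.
Definition red : color := true.
Definition blue : color := false.

Definition vpair (V : finType) : finType := {e : {set V} | #|e| == 2%N}.

(* A pair (G, c) on the vertex set V: the edges of G are the e with
   g e != None, and c e = k when g e = Some k. *)
Definition colored_graph (V : finType) : finType :=
  {ffun vpair V -> option color}.

(* [insub] fails exactly when u = v, so there are no loops. *)
Definition edge_color (V : finType) (g : colored_graph V) (u v : V) :
    option color :=
  if insub [set u; v]%SET is Some e then g e else None.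

Definition adapted (V : finType) (g : colored_graph V)
    (sigma : {ffun V -> color}) : bool :=
  [forall u, forall v, forall k,
    (edge_color g u v == Some k) ==> (sigma u != k) || (sigma v != k)].

Definition adaptably_2_colorable (V : finType) (g : colored_graph V) : bool :=
  [exists sigma : {ffun V -> color}, adapted g sigma].

(* The parameter of the random graph has to lie in [0, 1]; other reals are
   projected onto this interval. With p = (2 +- eps) / n this happens only for
   finitely many n, or for (2 - eps) / n with eps > 2. *)
Definition clamp01 (R : realType) (p : R) : R := Num.max 0 (Num.min p 1).

Definition slot_weight (R : realType) (p : R) (s : option color) : R :=
  if s is Some _ then clamp01 p / 2 else 1 - clamp01 p.

(* The probability mass function of G(n, p, 2): a product over the pairs of
   vertices, since distinct pairs are independent. *)
Definition random_colored_graph (R : realType) (n : nat) (p : R)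
    (g : colored_graph 'I_n) : R :=
  \prod_(e : vpair 'I_n) slot_weight p (g e).

Definition prob (R : realType) (T : finType) (mu : T -> R) (A : pred T) : R :=
  \sum_(x | A x) mu x.

Definition whp (R : realType) (T : nat -> finType) (mu : forall n, T n -> R)
    (A : forall n, pred (T n)) : Prop :=
  ((fun n => prob (mu n) (A n)) @ \oo --> (1 : R))%classic.

Lemma clamp01_id (R : realType) (p : R) : 0 <= p <= 1 -> clamp01 p = p.
Proof. by case/andP=> p0 p1; rewrite /clamp01 (min_idPl p1) (max_idPr p0). Qed.

Lemma clamp01_ge0 (R : realType) (p : R) : 0 <= clamp01 p.
Proof. by rewrite /clamp01 le_max lexx. Qed.

Lemma clamp01_le1 (R : realType) (p : R) : clamp01 p <= 1.
Proof. by rewrite /clamp01 ge_max ler01 ge_min lexx orbT. Qed.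

Lemma random_colored_graph_ge0 (R : realType) (n : nat) (p : R)
    (g : colored_graph 'I_n) : 0 <= random_colored_graph p g.
Proof.
apply: prodr_ge0 => e _; rewrite /slot_weight; case: (g e) => [_|].
  by rewrite divr_ge0 ?clamp01_ge0.
by rewrite subr_ge0 clamp01_le1.
Qed.

Lemma random_colored_graph_sum1 (R : realType) (n : nat) (p : R) :
  prob (@random_colored_graph R n p) predT = 1.
Proof.
rewrite /prob /random_colored_graph.
rewrite -(bigA_distr_bigA (fun _ s => slot_weight p s)) /=.
apply: big1 => e _; rewrite (bigD1 None) //=.
rewrite (bigD1 (Some red)) //= (bigD1 (Some blue)) //= big1.
  by rewrite addr0 -splitr subrK.
by case=> [[]|].
Qed.

Lemma edge_colorC (V : finType) (g : colored_graph V) (u v : V) :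
  edge_color g u v = edge_color g v u.
Proof. by rewrite /edge_color finset.setUC. Qed.

Lemma edge_color_irr (V : finType) (g : colored_graph V) (u : V) :
  edge_color g u u = None.
Proof. by rewrite /edge_color finset.setUid insubF // cards1. Qed.

(* Main.v *)
(* Colour [k] on the edge [uv] says that [u = k] forces [v <> k]; forcing chains
   are therefore paths whose edge colours alternate, and from a given vertex
   they branch with mean [n p / 2].
   Below the threshold: in a minimal uncolourable vertex set every vertex meets
   both colours, so both ends of a longest alternating path have a further edge
   back into the path. This gives [N] vertices carrying an alternating path and
   two extra edges, and the expected number of such configurations is at most
   [(8 / n) sum_N N^4 (n p / 2)^N = O(1 / n)].
   Above the threshold: a depth-first search along alternating paths asks, for
   the current end [u] of the path and an unvisited [v], whether [uv] has the
   colour that comes next. Each question is answered positively with a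
   probability [q1] slightly smaller than [p / 2]; after a negative answer the
   conditional law of [uv] still gives each colour a probability at least
   [p / 2 - q1]. If the search finished [m] vertices without meeting a path of
   linear length, it would have had few positive answers among many questions.
   Along a path of linear length, a blue edge between even vertices of the first
   half and a red edge between even vertices of the second half contradict each
   other, and the probability left over provides both. *)
Require Import Defs.
From mathcomp Require Import boolp classical_sets reals topology normedtype.
From mathcomp Require Import sequences exp.
From mathcomp Require Import all_boot all_order all_algebra.
From mathcomp Require Import zify ring lra.
Set Implicit Arguments.
Unset Strict Implicit.
Unset Printing Implicit Defensive.
Import Order.TTheory GRing.Theory Num.Theory.
Import numFieldNormedType.Exports.
Local Open Scope ring_scope.

(** * Unordered pairs of vertices *)

Lemma set2_eq (V : finType) (a b x y : V) :
  [set a; b] = [set x; y] -> (a = x /\ b = y) \/ (a = y /\ b = x).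
Proof.
move=> E.
have: a \in [set x; y] by rewrite -E set21.
have: b \in [set x; y] by rewrite -E set22.
have: x \in [set a; b] by rewrite E set21.
have: y \in [set a; b] by rewrite E set22.
rewrite !inE => /orP[]/eqP h1 /orP[]/eqP h2 /orP[]/eqP h3 /orP[]/eqP h4;
  subst; by [left | right | left; split].
Qed.

Lemma edge_color_val (V : finType) (u v : V) : u != v ->
  {e : vpair V | val e = [set u; v] & forall g, edge_color g u v = g e}.
Proof.
move=> uv; have h : #|[set u; v]| == 2%N by rewrite cards2 uv.
by exists (Sub [set u; v] h) => // g; rewrite /edge_color insubT.
Qed.

(** * Product laws on coloured graphs *)

Section Weights.
Variables (R : realType) (V : finType).

(* A product law on coloured graphs, pair by pair. Conditioning on a question
   about a pair is done by changing the factor of that pair ([pr_mix]). *)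
Definition weights := {set V} -> option color -> R.
Implicit Types (W : weights) (A B : pred (colored_graph V)).

Definition pr W A : R := \sum_(g | A g) \prod_(e : vpair V) W (val e) (g e).

Definition stochastic W := forall x,
  (forall s, 0 <= W x s) /\ W x None + W x (Some red) + W x (Some blue) = 1.

Lemma sum_option_color (F : option color -> R) :
  \sum_s F s = F None + F (Some red) + F (Some blue).
Proof.
rewrite (bigD1 None) //= (bigD1 (Some red)) //= (bigD1 (Some blue)) //= big1.
  by rewrite addr0 addrA.
by case=> [[]|].
Qed.

Lemma stochastic_ge0 W (x : {set V}) s : stochastic W -> 0 <= W x s.
Proof. by move=> /(_ x)[]. Qed.

Lemma stochastic_sum W (x : {set V}) : stochastic W -> \sum_s W x s = 1.
Proof. by move=> /(_ x)[_]; rewrite sum_option_color. Qed.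

Lemma weight_ge0 W (g : colored_graph V) :
  stochastic W -> 0 <= \prod_(e : vpair V) W (val e) (g e).
Proof. by move=> W1; apply: prodr_ge0 => e _; exact: stochastic_ge0. Qed.

Lemma pr_ge0 W A : stochastic W -> 0 <= pr W A.
Proof. by move=> W1; apply: sumr_ge0 => g _; exact: weight_ge0. Qed.

Lemma pr_predT W : stochastic W -> pr W predT = 1.
Proof.
move=> W1; rewrite /pr -(bigA_distr_bigA (fun e s => W (val e) s)) /=.
by apply: big1 => e _; exact: stochastic_sum.
Qed.

Lemma prC W A : stochastic W -> pr W A = 1 - pr W (predC A).
Proof.
move=> W1; apply: (@addIr _ (pr W (predC A))); rewrite subrK -(pr_predT W1).
by rewrite [RHS](bigID A).
Qed.

Lemma pr_le1 W A : stochastic W -> pr W A <= 1.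
Proof. by move=> W1; rewrite prC // gerBl pr_ge0. Qed.

(** Only graphs of non-zero weight have to be covered; this makes answers already fixed in [W]
    available as facts about the graph. *)
Lemma pr_union (I : finType) W A (B : I -> pred (colored_graph V)) :
  stochastic W ->
  (forall g : colored_graph V, \prod_(e : vpair V) W (val e) (g e) != 0 -> A g ->
    [exists i, B i g]) ->
  pr W A <= \sum_i pr W (B i).
Proof.
move=> W1 AB; rewrite /pr (exchange_big_dep predT) //= [leLHS]big_mkcond.
apply: ler_sum => g _.
have [/existsP[i Bi]|nB] := boolP [exists i, B i g].
  have S0 : 0 <= \sum_(i | B i g) \prod_(e : vpair V) W (val e) (g e).
    by apply: sumr_ge0 => *; exact: weight_ge0.
  case: ifP => _ //.
  by rewrite (bigD1 i) //= lerDl; apply: sumr_ge0 => *; exact: weight_ge0.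
rewrite [leRHS]big1; last first.
  by move=> i Bi; case/existsP: nB; exists i.
case: ifP => // Ag; have [->//|p0] := eqVneq (\prod_(e : vpair V) W (val e) (g e)) 0.
by rewrite (AB g p0 Ag) in nB.
Qed.

(** Distinct pairs are independent, so the constraints on the pairs in [D] multiply, while each free
    pair contributes the factor 1. *)
Lemma pr_cylinder W A (D : {set {set V}}) (P : {set V} -> pred (option color)) :
  stochastic W -> (forall x, x \in D -> #|x| = 2%N) ->
  (forall g : colored_graph V, A g ->
    forall e : vpair V, val e \in D -> P (val e) (g e)) ->
  pr W A <= \prod_(x in D) \sum_(s | P x s) W x s.
Proof.
move=> W1 D2 AP.
pose Q (e : vpair V) := [pred s | (val e \in D) ==> P (val e) s].
have -> : \prod_(x in D) \sum_(s | P x s) W x s =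
    \prod_(e : vpair V) \sum_(s | Q e s) W (val e) s.
  have -> : D = val @: [set e : vpair V | val e \in D].
    apply/setP => x; apply/idP/imsetP => [xD|[e]]; last by rewrite inE => eD ->.
    have x2 : #|x| == 2%N by rewrite D2.
    by exists (Sub x x2) => //; rewrite inE.
  rewrite big_imset /=; last by move=> e f _ _; exact: val_inj.
  rewrite [RHS](bigID (fun e : vpair V => val e \in D)) /=.
  rewrite [X in _ = _ * X]big1 ?mulr1; last first.
    move=> e eD; rewrite -[RHS](stochastic_sum (val e) W1).
    by apply: eq_bigl => s; rewrite /= (negbTE eD).
  apply: eq_big => [e|e]; rewrite inE // => eD.
  by apply: eq_bigl => s; rewrite /= eD.
rewrite bigA_distr_big_dep /pr [leLHS]big_mkcond [leRHS]big_mkcond /=.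
apply: ler_sum => g _; case: ifP => Ag; last first.
  by case: ifP => _ //; exact: weight_ge0.
suff -> : g \in family Q by [].
by apply/familyP => e; rewrite inE /=; apply/implyP => /AP; exact.
Qed.

Definition update W (x : {set V}) (f : option color -> R) : weights :=
  fun y => if y == x then f else W y.

(** The product is linear in the factor of a single pair. With [a] and [b] the probabilities of the
    two answers, this is the law of total probability for one question. *)
Lemma pr_mix W A (x : {set V}) (a b : R) f1 f2 : #|x| = 2%N ->
  (forall s, W x s = a * f1 s + b * f2 s) ->
  pr W A = a * pr (update W x f1) A + b * pr (update W x f2) A.
Proof.
move=> x2 Wx; have x2' : #|x| == 2%N by rewrite x2.
rewrite /pr !mulr_sumr -big_split /=; apply: eq_bigr => g _.
pose e0 : vpair V := Sub x x2'.
have uE f : update W x f (val e0) = f by rewrite /update eqxx.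
have split_e0 (F : vpair V -> R) : \prod_e F e = F e0 * \prod_(e | e != e0) F e.
  by rewrite (bigD1 e0).
rewrite [LHS]split_e0 [X in a * X]split_e0 [X in b * X]split_e0 !uE Wx.
rewrite mulrDl !mulrA; congr (_ * _ + _ * _); apply: eq_bigr => e ne;
  by rewrite /update ifN // -[x]/(val e0) (inj_eq val_inj).
Qed.

Lemma stochastic_update W x f : stochastic W -> (forall s, 0 <= f s) ->
  f None + f (Some red) + f (Some blue) = 1 -> stochastic (update W x f).
Proof. by move=> W1 f0 f1 y; rewrite /update; case: ifP. Qed.

Lemma update_out W (u v x y : V) f : v != x -> v != y ->
  update W [set u; v] f [set x; y] = W [set x; y].
Proof.
move=> vx vy; rewrite /update; case: eqP => // E.
have : v \in [set x; y] by rewrite E set22.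
by rewrite !inE (negbTE vx) (negbTE vy).
Qed.

Definition uniform_weights (q : R) : weights :=
  fun _ s => if s is Some _ then q else 1 - 2 * q.

Lemma uniform_weights_stochastic q : 0 <= q -> 2 * q <= 1 ->
  stochastic (uniform_weights q).
Proof.
move=> q0 q1 x; rewrite /uniform_weights; split => [[_|] //|]; last by lra.
by rewrite subr_ge0.
Qed.

End Weights.

(** * Long alternating paths and the depth-first search for them *)

Lemma adaptedP (V : finType) (g : colored_graph V) (sigma : {ffun V -> color}) :
  reflect (forall u v k, edge_color g u v = Some k ->
             (sigma u != k) || (sigma v != k))
          (adapted g sigma).
Proof.
apply: (iffP idP) => [/forallP h u v k /eqP E|h].
  by have /forallP/(_ v)/forallP/(_ k)/implyP := h u; apply.
apply/forallP => u; apply/forallP => v; apply/forallP => k.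
by apply/implyP => /eqP; exact: h.
Qed.

Section Search.
Variables (R : realType) (V : finType) (x0 : V).
Implicit Types (W : weights R V) (s : seq V) (g : colored_graph V).

(** Colour of the edge from vertex [i] to vertex [i.+1] of the path. If vertex [i] has this colour,
    the edge forces the opposite one, [tree_color i.+1], on the next vertex. *)
Definition tree_color (i : nat) : color := ~~ odd i.

(** Steps of two keep to positions with one and the same tree colour, and no two of them are
    consecutive on the path. *)
Definition block_free s (o r : nat) (k : color) : pred (colored_graph V) :=
  fun g => [forall i : 'I_r, forall j : 'I_r,
    edge_color g (nth x0 s (o + i.*2)) (nth x0 s (o + r.*2 + j.*2)) != Some k].

Definition spread W s (eta : R) := forall i j k, (i < j < size s)%N -> j != i.+1 ->
  eta <= W [set nth x0 s i; nth x0 s j] (Some k).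

Lemma nth_neq s i j : uniq s -> (i < size s)%N -> (j < size s)%N -> i != j ->
  nth x0 s i != nth x0 s j.
Proof. by move=> us si sj ij; rewrite nth_uniq. Qed.

(** The [r * r] pairs are distinct and none is a path edge, so each avoids [k] with probability at
    most [1 - eta], independently. *)
Lemma pr_block_free W s o r k eta : stochastic W -> uniq s ->
  (o + r.*2.*2 <= size s)%N -> spread W s eta ->
  pr W (block_free s o r k) <= (1 - eta) ^+ (r * r).
Proof.
move=> W1 us os Ws.
pose h (p : 'I_r * 'I_r) :=
  [set nth x0 s (o + p.1.*2); nth x0 s (o + r.*2 + p.2.*2)].
have hne (p : 'I_r * 'I_r) :
    nth x0 s (o + p.1.*2) != nth x0 s (o + r.*2 + p.2.*2).
  by apply: nth_neq => //; case: p => [[i ?] [j ?]] /=; lia.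
have hinj : injective h.
  move=> [[i hi] [j hj]] [[i' hi'] [j' hj']] /set2_eq /=.
  have inj a b : (a < size s)%N -> (b < size s)%N ->
      nth x0 s a = nth x0 s b -> a = b.
    by move=> ha hb /eqP; rewrite nth_uniq // => /eqP.
  by case=> [] [/inj e1 /inj e2]; congr (_, _); apply: val_inj => /=; lia.
pose D := [set h p | p in [set: 'I_r * 'I_r]].
have DD x : x \in D -> exists2 p, x = h p & p \in [set: 'I_r * 'I_r].
  by case/imsetP => p ? ->; exists p.
apply: le_trans
  (pr_cylinder (D := D) (P := fun _ => [pred t | t != Some k]) W1 _ _) _.
- by move=> x /DD[p -> _]; rewrite cards2 hne.
- move=> g /forallP bf e /DD[p ep _] /=.
  have [e' e'p ge'] := edge_color_val (hne p).
  have -> : e = e' by apply: val_inj; rewrite e'p ep.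
  by rewrite -ge'; have /forallP/(_ p.2) := bf p.1.
have <- : #|D| = (r * r)%N.
  by rewrite card_imset // cardsT card_prod !card_ord.
rewrite -prodr_const; apply: ler_prod => x /DD[p -> _]; apply/andP; split.
  by apply: sumr_ge0 => *; exact: stochastic_ge0.
have := stochastic_sum (h p) W1; rewrite (bigD1 (Some k)) //= => <-.
by rewrite lerBrDl lerD2r Ws //; case: p => [[i ?] [j ?]] /=; lia.
Qed.

Definition alternating W s := forall i t, (i.+1 < size s)%N ->
  t != Some (tree_color i) -> W [set nth x0 s i; nth x0 s i.+1] t = 0.

Lemma pr_colorable_long_path W s r eta : stochastic W -> uniq s ->
  (size s = r * 8)%N -> spread W s eta -> alternating W s ->
  pr W (@adaptably_2_colorable V) <= (1 - eta) ^+ (r * r) *+ 2.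
Proof.
move=> W1 us sr Ws Wt.
pose B (b : bool) := if b then block_free s (r.*2.*2) r red
                     else block_free s 0 r blue.
apply: le_trans (pr_union (B := B) W1 _) _; last first.
  rewrite big_bool mulr2n; apply: lerD; apply: pr_block_free => //; lia.
move=> g g0 /existsP[sigma /adaptedP adg]; apply: contraT.
move=> /existsPn nB.
(* A graph of non-zero weight contains the path with its alternating colours, because [W] vanishes
   on every other state of these pairs. *)
have tree i : (i.+1 < size s)%N ->
    edge_color g (nth x0 s i) (nth x0 s i.+1) = Some (tree_color i).
  move=> ils; have ne : nth x0 s i != nth x0 s i.+1 by apply: nth_neq => //; lia.
  have [e ep ge] := edge_color_val ne; rewrite ge; apply/eqP.
  apply: contraNT g0 => gne; rewrite prodf_seq_eq0 /=; apply/hasP; exists e.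
    by rewrite mem_index_enum.
  by rewrite ep Wt.
(* Once a vertex has its tree colour, all later vertices of the path have theirs. *)
have prop i d : (i + d < size s)%N -> sigma (nth x0 s i) = tree_color i ->
    sigma (nth x0 s (i + d)) = tree_color (i + d).
  move=> + si; elim: d => [|d IH] ids; first by rewrite addn0.
  rewrite addnS in ids *; have := adg _ _ _ (tree _ ids).
  rewrite IH ?eqxx /=; last by lia.
  by rewrite /tree_color /=; case: (sigma _) (odd _) => [] [].
have /forallPn[i /forallPn[j]] := nB false.
rewrite negbK add0n => /eqP/adg.
have /forallPn[i' /forallPn[j']] := nB true.
rewrite negbK => /eqP/adg.
have ev a : tree_color (a.*2) = red by rewrite /tree_color odd_double.
case: i j i' j' => [i hi] [j hj] [i' hi'] [j' hj'] /=.
rewrite -!doubleD => late early.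
(* One end of the blue edge is red. If it is the earlier end, propagation makes the later one red as
   well. *)
have sj : sigma (nth x0 s (r + j).*2) = red.
  case: (boolP (sigma (nth x0 s i.*2))) => si; last first.
    by move: early; rewrite (negbTE si); case: (sigma _).
  rewrite -(ev (r + j)%N) (_ : (r + j).*2 = i.*2 + (r + j - i).*2)%N; last by lia.
  by apply: prop; rewrite ?ev //; lia.
have fin a : (r.*2 <= a < r.*2.*2)%N -> sigma (nth x0 s a.*2) = red.
  move=> ha; rewrite -(ev a) (_ : a.*2 = (r + j).*2 + (a - (r + j)).*2)%N; last by lia.
  by apply: prop; rewrite ?ev //; lia.
by move: late; rewrite !fin //; lia.
Qed.

(* The search has finished the vertices of [S], its current path is [s] with the
   last element as the active end, it has asked the ordered pairs in [Q], and
   [a] answers were positive. [W] is the law of the graph given the answers. *)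
Record search_state W (S : {set V}) s (Q : {set V * V}) (a : nat) (q eta : R) : Prop :=
  SearchState {
    ss_stoch : stochastic W;
    ss_uniq : uniq s;
    ss_disj : forall x, x \in s -> x \notin S;
    ss_spread : spread W s eta;
    ss_alt : alternating W s;
    ss_fresh : forall u v t, v \notin S -> v \notin s -> u != v -> (u, v) \notin Q ->
      W [set u; v] t = uniform_weights q [set u; v] t;
    ss_res : forall u v k, v \notin S -> v \notin s -> u != v ->
      eta <= W [set u; v] (Some k);
    ss_done : forall u v, u \in S -> v \notin S -> v \notin s -> (u, v) \in Q;
    ss_seen : forall u v, (u, v) \in Q -> (u \in S) || (u \in s);
    ss_count : (a <= #|S| + size s)%N
  }.

Lemma search_state_init (q q1 : R) : 0 <= q1 -> 2 * q <= 1 -> q1 <= q ->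
  search_state (uniform_weights q) set0 [::] set0 0 q (q - q1).
Proof.
move=> q10 q2 q12; split=> //.
- by apply: uniform_weights_stochastic => //; lra.
- by move=> i j k /andP[_]; rewrite ltn0.
- by move=> u v k _ _ _; rewrite /uniform_weights; lra.
- by move=> u v; rewrite inE.
- by move=> u v; rewrite inE.
Qed.

Lemma search_state_pop W S s u Q a q eta :
  search_state W S (rcons s u) Q a q eta ->
  (forall v, v \notin S -> v \notin rcons s u -> (u, v) \in Q) ->
  search_state W (u |: S) s Q a q eta.
Proof.
move=> [W1 us dis sp al fr re dn se co] uQ.
have uS : u \notin S by apply: dis; rewrite mem_rcons mem_head.
have/andP[us' us''] : (u \notin s) && uniq s by rewrite -rcons_uniq.
have out v : v \notin u |: S -> v \notin s -> (v \notin S) /\ (v \notin rcons s u).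
  by rewrite !inE mem_rcons inE !negb_or => /andP[-> ->] ->.
split=> //.
- move=> x xs; rewrite !inE negb_or dis ?mem_rcons ?inE ?xs ?orbT // andbT.
  by apply: contraNneq us' => <-.
- move=> i j k /andP[ij js] ji; have := sp i j k.
  by rewrite size_rcons !nth_rcons js (ltn_trans ij js); apply => //; lia.
- move=> i t ils ti; have := al i t.
  by rewrite size_rcons !nth_rcons ils (ltnW ils); apply => //; lia.
- by move=> x v t /out h /h[vS vs]; exact: fr.
- by move=> x v k /out h /h[vS vs]; exact: re.
- move=> x v; rewrite in_setU1 => /orP[/eqP-> | xS] /out h /h[vS vs].
    exact: uQ.
  exact: dn.
- by move=> x v /se; rewrite mem_rcons !inE orbCA orbA.
- by rewrite size_rcons in co; rewrite cardsU1 uS; lia.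
Qed.

(** A new root enters the path without a positive answer, which is why [ss_count] is only an
    inequality. *)
Lemma search_state_root W S v Q a q eta :
  search_state W S [::] Q a q eta -> v \notin S ->
  search_state W S [:: v] Q a q eta.
Proof.
move=> [W1 us dis sp al fr re dn se co] vS; split=> //.
- by move=> x; rewrite inE => /eqP->.
- by move=> i j k /andP[ij]; rewrite ltnS leqn0 => /eqP j0; rewrite j0 in ij.
- by move=> u w t wS _; exact: fr.
- by move=> u w k wS _; exact: re.
- by move=> u w uS wS _; exact: dn.
- by move=> u w /se; rewrite orbF => ->.
- by apply: (leq_trans co); rewrite leq_add2l.
Qed.

(** The new factor is the uniform one with mass [q1] taken off the requested colour, renormalised.
    That colour keeps [(q - q1) / (1 - q1)], which is at least [q - q1]. *)
Lemma search_state_miss W S s u v Q a (q q1 : R) :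
  0 <= q1 -> q1 <= q -> 2 * q <= 1 ->
  search_state W S (rcons s u) Q a q (q - q1) ->
  v \notin S -> v \notin rcons s u -> (u, v) \notin Q ->
  search_state
    (update W [set u; v] (fun t =>
       (uniform_weights q [set u; v] t
         - q1 * (t == Some (tree_color (size s)))%:R) / (1 - q1)))
    S (rcons s u) ((u, v) |: Q) a q (q - q1).
Proof.
move=> q10 q1q q2 [W1 us dis sp al fr re dn se co] vS vs uvQ.
have d0 : 0 < 1 - q1 by lra.
have uin : u \in rcons s u by rewrite mem_rcons mem_head.
have nvs i : (i < size (rcons s u))%N -> v != nth x0 (rcons s u) i.
  by move=> hi; apply: contraNneq vs => ->; exact: mem_nth.
have old x w : w \notin S -> w \notin rcons s u -> (x, w) != (u, v) ->
    [set x; w] != [set u; v].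
  move=> wS ws /negP ne; apply/eqP => /set2_eq[[xu wv]|[_ wu]].
    by apply: ne; rewrite xu wv.
  by rewrite wu uin in ws.
split=> //.
- apply: stochastic_update => // [t|].
    apply: divr_ge0; last exact: ltW.
    by case: t => [k|]; [case: (_ == _)|] => /=; lra.
  rewrite -!mulrDl; apply: (canLR (mulfK _)); first by rewrite gt_eqF.
  by case: tree_color => /=; lra.
- move=> i j k /andP[ij js] ji.
  by rewrite update_out ?nvs ?sp ?ij ?(ltn_trans ij js).
- move=> i t ils ti; rewrite update_out ?nvs ?al // ltnW //.
- move=> x w t wS ws xw; rewrite in_setU1 negb_or => /andP[h hQ].
  by rewrite /update ifN ?fr // old.
- move=> x w k wS ws xw; rewrite /update; case: ifP => [_|_]; last exact: re.
  by rewrite ler_pdivlMr //; case: (_ == _) => /=; nra.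
- by move=> x w xS wS ws; rewrite in_setU1 dn ?orbT.
- by move=> x w; rewrite in_setU1 => /orP[/eqP[-> _]|/se //]; rewrite uin orbT.
Qed.

(** While [v] was outside, [ss_res] protected its pairs with the path. Now that [v] is the new end,
    this becomes [spread] for its pairs with all vertices before [u]. *)
Lemma search_state_hit W S s u v Q a (q eta : R) :
  search_state W S (rcons s u) Q a q eta ->
  v \notin S -> v \notin rcons s u ->
  search_state
    (update W [set u; v] (fun t => (t == Some (tree_color (size s)))%:R))
    S (rcons (rcons s u) v) ((u, v) |: Q) a.+1 q eta.
Proof.
move=> [W1 us dis sp al fr re dn se co] vS vs.
have uin : u \in rcons s u by rewrite mem_rcons mem_head.
have nvs i : (i < size (rcons s u))%N -> v != nth x0 (rcons s u) i.
  by move=> hi; apply: contraNneq vs => ->; exact: mem_nth.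
have out w : w \notin rcons (rcons s u) v -> w != v /\ w \notin rcons s u.
  by rewrite mem_rcons inE negb_or => /andP[].
have old x w : w \notin rcons (rcons s u) v -> [set x; w] != [set u; v].
  move=> /out[wv ws]; apply/eqP => /set2_eq[[_ /eqP]|[_ wu]].
    exact/negP.
  by rewrite wu uin in ws.
split=> //.
- by apply: stochastic_update => //; case: tree_color => /=; lra.
- by rewrite rcons_uniq vs.
- by move=> x; rewrite mem_rcons inE => /orP[/eqP->|/dis].
- move=> i j k /andP[ij]; rewrite size_rcons ltnS leq_eqVlt => /orP[/eqP js|js] ji.
    have ils : (i < size (rcons s u))%N by rewrite -js.
    rewrite js !(nth_rcons _ (rcons s u)) ils ltnn eqxx.
    have ne : nth x0 (rcons s u) i != u.
      rewrite -[X in _ != X](last_rcons x0 s u) -nth_last.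
      by apply: nth_neq; rewrite ?size_rcons //; rewrite size_rcons in js; lia.
    rewrite /update ifN; first by apply: re => //; rewrite eq_sym nvs.
    apply/eqP => /set2_eq[[/eqP]|[/eqP]]; rewrite ?(negbTE ne) //.
    by rewrite eq_sym (negbTE (nvs _ ils)).
  have ils := ltn_trans ij js.
  rewrite !(nth_rcons _ (rcons s u)) ils js update_out ?nvs //.
  by apply: sp => //; exact/andP.
- move=> i t; rewrite size_rcons ltnS leq_eqVlt => /orP[/eqP si|si] ti.
    have is_ : i = size s by move: si; rewrite size_rcons => -[].
    have -> : nth x0 (rcons (rcons s u) v) i = u.
      by rewrite !nth_rcons size_rcons is_ ltnS leqnn ltnn eqxx.
    rewrite (nth_rcons _ (rcons s u)) si ltnn eqxx /update eqxx.
    by rewrite -is_ (negbTE ti).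
  have ils := ltnW si; rewrite !(nth_rcons _ (rcons s u)) ils si update_out ?nvs //.
  exact: al.
- move=> x w t wS ws xw; rewrite in_setU1 negb_or => /andP[_ hQ].
  rewrite /update ifN ?old //; apply: fr => //; exact: (out _ ws).2.
- move=> x w k wS ws xw; rewrite /update ifN ?old //; apply: re => //.
  exact: (out _ ws).2.
- move=> x w xS wS /out[_ ws]; by rewrite in_setU1 dn ?orbT.
- move=> x w; rewrite in_setU1 mem_rcons !inE => /orP[/eqP[-> _]|/se].
    by rewrite uin !orbT.
  by case/orP => ->; rewrite ?orbT.
- by rewrite size_rcons; lia.
Qed.

Lemma card_outside W S s Q a q eta : search_state W S s Q a q eta ->
  #|~: (S :|: [set x in s])| = (#|V| - (#|S| + size s))%N
  /\ (#|S| + size s <= #|V|)%N.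
Proof.
move=> [_ us dis _ _ _ _ _ _ _].
have e : #|S :|: [set x in s]| = (#|S| + size s)%N.
  rewrite cardsU (_ : S :&: _ = set0) ?cards0 ?subn0; last first.
    apply/setP => x; rewrite !inE; apply/negP => /andP[xS /dis].
    by rewrite xS.
  by rewrite cardsE (card_uniqP us).
by rewrite -e max_card cardsCs setCK.
Qed.

(* [search_bound] is a martingale along the questions, [1 - q1 (1 - z)] being the
   expectation of [z] to the number of positive answers to a single one. It is
   at least [1] once [b >= M] questions got only [a <= K] positive answers. *)
Definition search_bound (q1 z : R) (M K a b : nat) : R :=
  (1 - q1 * (1 - z))^-1 ^+ b * (1 - q1 * (1 - z)) ^+ M * (z ^+ a * z^-1 ^+ K).

Lemma search_rate (q1 z : R) : 0 <= q1 -> 2 * q1 <= 1 -> 0 < z -> z <= 1 ->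
  0 < 1 - q1 * (1 - z) <= 1.
Proof.
move=> q10 q12 z0 z1; have qz := mulr_ge0 q10 (ltW z0).
by rewrite gerBl mulr_ge0 ?subr_ge0 // andbT mulrBr mulr1; lra.
Qed.

Lemma search_bound_step (q1 z : R) M K a b : 0 < 1 - q1 * (1 - z) ->
  q1 * search_bound q1 z M K a.+1 b.+1 + (1 - q1) * search_bound q1 z M K a b.+1
    = search_bound q1 z M K a b.
Proof.
move=> r0; rewrite /search_bound !exprS.
have := divff (lt0r_neq0 r0); move: (_^-1) => i ri.
transitivity ((1 - q1 * (1 - z)) * i * (i ^+ b * (1 - q1 * (1 - z)) ^+ M
  * (z ^+ a * z^-1 ^+ K))); first by ring.
by rewrite ri mul1r.
Qed.

Lemma search_bound_ge1 (q1 z : R) M K a b : 0 < 1 - q1 * (1 - z) <= 1 ->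
  0 < z -> z <= 1 -> (a <= K)%N -> (M <= b)%N -> 1 <= search_bound q1 z M K a b.
Proof.
have aux (x : R) i j : 0 < x -> x <= 1 -> (i <= j)%N -> 1 <= x ^+ i * x^-1 ^+ j.
  move=> xp x1 ij; rewrite exprVn ler_pdivlMr ?exprn_gt0 // mul1r.
  by apply: ler_wiXn2l => //; exact: ltW.
move=> /andP[r0 r1] zp z1 ha hb.
rewrite /search_bound -[leLHS]mulr1 [X in _ <= X * _]mulrC.
by apply: ler_pM => //; exact: aux.
Qed.

Lemma search_bound_ge0 (q1 z : R) M K a b : 0 < 1 - q1 * (1 - z) -> 0 < z ->
  0 <= search_bound q1 z M K a b.
Proof. by move=> r0 z0; rewrite /search_bound !mulr_ge0 ?exprn_ge0 ?invr_ge0 ?ltW. Qed.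

(** Induction along the search: a question averages both sides in the same way, by [pr_mix] and
    [search_bound_step]. The second summand pays for stopping with a path on [r * 8] vertices; on
    stopping with [m] finished vertices the first summand is at least 1. *)
Lemma pr_colorable_search (q q1 z : R) (m r : nat) W S s Q a :
  0 <= q1 -> q1 <= q -> 2 * q <= 1 -> 0 < z -> z <= 1 ->
  (m + r * 8 <= #|V|)%N ->
  search_state W S s Q a q (q - q1) -> (#|S| <= m)%N -> (size s <= r * 8)%N ->
  pr W (@adaptably_2_colorable V) <=
    search_bound q1 z (m * (#|V| - (m + r * 8))) (m + r * 8) a #|Q|
    + (1 - (q - q1)) ^+ (r * r) *+ 2.
Proof.
have dec_hit N i n S' l c : (i < N)%N -> (S' + l < n)%N ->
    (N - i + (n - (S' + l)).*2 + l <= c)%N ->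
    (N - i.+1 + (n - (S' + l.+1)).*2 + l.+1 < c)%N by lia.
have dec_miss N i j l c : (i < N)%N -> (N - i + j + l <= c)%N ->
    (N - i.+1 + j + l < c)%N by lia.
move=> q10 q1q q2 z0 z1 mr.
have rho : 0 < 1 - q1 * (1 - z) <= 1 by apply: search_rate => //; lra.
have rho0 : 0 < 1 - q1 * (1 - z) by case/andP: rho.
have kappa_ge0 : 0 <= (1 - (q - q1)) ^+ (r * r) *+ 2.
  by rewrite mulrn_wge0 // exprn_ge0; lra.
have [n nV] : {n | n = #|V|} by exists #|V|.
rewrite -!nV in mr *.
(* The measure decreases in every move: a question lowers the first term, a new path vertex costs 2
   in the second and adds 1 to the third, and backtracking lowers the third alone. *)
have [k] := ubnP ((n * n - #|Q|) + (n - (#|S| + size s)).*2 + size s)%N.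
elim: k W S s Q a => // k IH W S s Q a + st Sm sr; rewrite ltnS => meas.
have W1 := ss_stoch st.
have [T1 T2] := card_outside st; rewrite -nV in T1 T2.
have [sr'|sr'] := eqVneq (size s) (r * 8)%N.
  rewrite -[leLHS]add0r; apply: lerD; first exact: search_bound_ge0.
  exact: pr_colorable_long_path (ss_uniq st) sr' (ss_spread st) (ss_alt st).
have [Sm'|Sm'] := eqVneq #|S| m.
  rewrite -[leLHS]addr0; apply: lerD => //; apply: le_trans (pr_le1 _ W1) _.
  apply: search_bound_ge1 => //; first by have := ss_count st; rewrite Sm'; lia.
  (* Every finished vertex has been asked about every unvisited one, which gives the required number
     of questions. *)
  have : setX S (~: (S :|: [set x in s])) \subset Q.
    apply/subsetP => -[x y]; rewrite !inE /= negb_or => /and3P[xS yS ys].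
    exact: (ss_done st).
  move/subset_leq_card; rewrite cardsX T1 Sm'; apply: leq_trans.
  by rewrite leq_mul2l leq_sub2l ?orbT // leq_add2l.
have {}Sm : (#|S| < m)%N by rewrite ltn_neqAle Sm' Sm.
have {}sr : (size s < r * 8)%N by rewrite ltn_neqAle sr' sr.
clear Sm' sr'.
case/lastP: s => [|s u] in st T1 T2 sr meas *.
  have /card_gt0P[v] : (0 < #|~: (S :|: [set x in [::]])|)%N.
    by rewrite T1 /=; lia.
  rewrite !inE orbF => vS; apply: IH (search_state_root st vS) _ _ => /=; try lia.
  by move: meas => /=; lia.
rewrite size_rcons in sr meas T2 T1.
have [v|none] := pickP [pred v | [&& v \notin S, v \notin rcons s u & (u, v) \notin Q]];
    last first.
  have su := search_state_pop st.
  have {}su : search_state W (u |: S) s Q a q (q - q1).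
    apply: su => v vS vs; move: (none v) => /=; rewrite vS vs /=.
    by move/negbT; rewrite negbK.
  have uS : u \notin S by apply: (ss_disj st); rewrite mem_rcons mem_head.
  have cu : #|u |: S| = #|S|.+1 by rewrite cardsU1 uS.
  apply: IH su _ _; rewrite ?cu ?(ltnW (ltnW sr)) // addSnnS.
  by rewrite -addnS.
move=> /and3P[vS vs uvQ].
have uv : u != v.
  by apply: contraNneq vs => <-; rewrite mem_rcons mem_head.
have cQ : #|(u, v) |: Q| = #|Q|.+1 by rewrite cardsU1 uvQ.
have Qn : (#|Q| < n * n)%N by rewrite -cQ nV -card_prod max_card.
have Tn : (#|S| + (size s).+1 < n)%N.
  have : (0 < #|~: (S :|: [set x in rcons s u])|)%N.
    by apply/card_gt0P; exists v; rewrite !inE negb_or vS.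
  by rewrite T1 subn_gt0.
(* The pair still has its uniform law, which splits into a positive answer of probability [q1] and
   the remainder. *)
rewrite (@pr_mix _ _ W _ [set u; v] q1 (1 - q1)
  (fun t => (t == Some (tree_color (size s)))%:R)
  (fun t => (uniform_weights q [set u; v] t
         - q1 * (t == Some (tree_color (size s)))%:R) / (1 - q1))); first last.
- move=> t; rewrite (ss_fresh st) //.
  rewrite [_ * (_ / _)]mulrC divfK; last by rewrite gt_eqF //; lra.
  by rewrite addrC subrK.
- by rewrite cards2 uv.
rewrite -search_bound_step // -cQ.
have -> (x y c : R) : q1 * x + (1 - q1) * y + c = q1 * (x + c) + (1 - q1) * (y + c).
  by ring.
apply: lerD; apply: ler_wpM2l => //; try lra.
  apply: IH (search_state_hit st vS vs) _ _; rewrite ?cQ ?size_rcons ?(ltnW Sm) //.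
  exact: dec_hit.
apply: IH (search_state_miss _ _ _ st vS vs uvQ) _ _;
  rewrite ?cQ ?size_rcons ?(ltnW Sm) ?(ltnW sr) //.
exact: dec_miss.
Qed.

End Search.

(** * Bicycles in uncolourable graphs *)

Section Bicycle.
Variables (V : finType) (g : colored_graph V).
Implicit Types (A B : {set V}) (t : seq (V * color)).

Definition colorable_on A := [exists sigma : {ffun V -> color},
  [forall u in A, forall v in A, forall k,
    (edge_color g u v == Some k) ==> (sigma u != k) || (sigma v != k)]].

Lemma colorable_onP A :
  reflect (exists sigma : V -> color, forall u v k, u \in A -> v \in A ->
             edge_color g u v = Some k -> (sigma u != k) || (sigma v != k))
          (colorable_on A).
Proof.
apply: (iffP existsP) => [[sigma h]|[sigma h]].
  exists sigma => u v k uA vA /eqP E.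
  by have /forall_inP/(_ u uA)/forall_inP/(_ v vA)/forallP/(_ k)/implyP := h; apply.
exists (finfun sigma); apply/forall_inP => u uA; apply/forall_inP => v vA.
by apply/forallP => k; apply/implyP => /eqP; rewrite !ffunE; exact: h.
Qed.

(** If [u] had no edge of colour [k] inside a minimal uncolourable set, a colouring of the other
    vertices would extend by giving [u] the colour [k]. *)
Lemma uncolorable_core : ~~ adaptably_2_colorable g ->
  exists A, [/\ ~~ colorable_on A, forall B, B \proper A -> colorable_on B &
    forall u k, u \in A -> exists2 v, v \in A & edge_color g u v = Some k].
Proof.
move=> ng.
have ngT : ~~ colorable_on setT.
  apply: contraNN ng => /colorable_onP[sigma h]; apply/existsP.
  by exists (finfun sigma); apply/adaptedP => u v k; rewrite !ffunE; exact: h.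
have [A /minsetP[nA minA] _] := minset_exists (P := [pred B | ~~ colorable_on B]) ngT.
have colB B : B \proper A -> colorable_on B.
  move=> BA; apply: contraT => nB; have := properxx A.
  by rewrite -{1}(minA B nB (proper_sub BA)) BA.
exists A; split=> // u k uA.
have [/exists_inP[v vA /eqP E]|/exists_inPn none] :=
  boolP [exists v in A, edge_color g u v == Some k]; first by exists v.
case/negP: (nA); have /colorable_onP[sigma h] := colB _ (properD1 uA).
apply/colorable_onP; exists (fun w => if w == u then k else sigma w).
move=> x y l xA yA E.
case: (eqVneq x u) => [xu|xu].
  by rewrite xu in E; apply/orP; left; apply: contraNneq (none y yA) => ->; rewrite E.
case: (eqVneq y u) => [yu|yu].
  rewrite yu edge_colorC in E; apply/orP; right.
  by apply: contraNneq (none x xA) => ->; rewrite E.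
by apply: h; rewrite // !inE ?xu ?yu.
Qed.

(** Implication between literals as in 2-SAT, [(v, k)] standing for the choice of [k] at [v]. *)
Definition forces : rel (V * color) := fun x y =>
  (y.2 == ~~ x.2) && (edge_color g x.1 y.1 == Some x.2).

Definition simple_path A t :=
  [&& sorted forces t, uniq [seq x.1 | x <- t] & all (fun x => x.1 \in A) t].

Lemma longest_simple_path A : exists2 t, simple_path A t &
  forall t', simple_path A t' -> (size t' <= size t)%N.
Proof.
pose P n := [exists t : n.-tuple (V * color), simple_path A t].
have P0 : exists n, P n by exists 0%N; apply/existsP; exists [tuple].
have Pub n : P n -> (n <= #|V|)%N.
  move=> /existsP[t /and3P[_ ut _]]; move/card_uniqP: ut.
  by rewrite size_map size_tuple => <-; exact: max_card.
case: (ex_maxnP P0 Pub) => n /existsP[t ht] maxn.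
exists t => // t' ht'; rewrite size_tuple; apply: maxn; apply/existsP.
by exists (in_tuple t').
Qed.

(** Counterpart of the bicycles of random 2-SAT: the two extra edges differ from each other and from
    the path edges, so the vertices of [t] carry one edge more than their number. *)
Definition bicycle t a b a' b' :=
  [/\ sorted forces t, uniq [seq x.1 | x <- t],
    [/\ a \in [seq x.1 | x <- t], b \in [seq x.1 | x <- t],
        a' \in [seq x.1 | x <- t] & b' \in [seq x.1 | x <- t]],
    [/\ edge_color g a b != None, edge_color g a' b' != None
       & [set a; b] != [set a'; b']] &
    forall x i, (i.+1 < size t)%N ->
      [set (nth x t i).1; (nth x t i.+1).1] != [set a; b] /\
      [set (nth x t i).1; (nth x t i.+1).1] != [set a'; b']].

Lemma uncolorable_bicycle : ~~ adaptably_2_colorable g ->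
  exists t a b a' b', bicycle t a b a' b'.
Proof.
move=> /uncolorable_core[A [nA colA deg]].
have [u0 u0A] : exists u, u \in A.
  apply/set0Pn; apply: contraNneq nA => ->; apply/colorable_onP.
  by exists (fun _ => red) => u v k; rewrite inE.
have [t ht tmax] := longest_simple_path A.
have n0 : (0 < size t)%N.
  by have := tmax [:: (u0, red)]; apply; rewrite /simple_path /= u0A.
set T := [seq x.1 | x <- t].
have /and3P[srt uT /allP tA] := ht.
pose z0 : V * color := (u0, red); pose y := nth z0 t.
have ysrt i : (i.+1 < size t)%N -> forces (y i) (y i.+1) by move/(sortedP z0): srt; apply.
have yT i : (i < size t)%N -> (y i).1 \in T by move=> ?; apply/map_f/mem_nth.
have yinj i j : (i < size t)%N -> (j < size t)%N -> (y i).1 = (y j).1 -> i = j.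
  move=> si sj; rewrite -!(nth_map z0 u0) // => /eqP; rewrite nth_uniq ?size_map //.
  by move/eqP.
have Ty a : a \in T -> exists2 i, (i < size t)%N & a = (y i).1.
  move=> /mapP[x xt ->]; exists (index x t); first by rewrite index_mem.
  by rewrite /y nth_index.
have TA a : a \in T -> a \in A by move=> /mapP[x /tA xA ->].
(* Maximality is stated for every rearrangement of [t], so that it also applies to rotations once
   the path closes into a cycle. *)
have noext z t' : z.1 \in A -> z.1 \notin T -> perm_eq t' t ->
    sorted forces (z :: t') || sorted forces (rcons t' z) -> False.
  move=> zA zT tt' so.
  have uz : uniq (map fst (z :: t')).
    rewrite /= (perm_uniq (perm_map _ tt')) -/T uT andbT.
    by rewrite (perm_mem (perm_map _ tt')).
  have az : all (fun x => x.1 \in A) (z :: t').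
    by rewrite /= zA; apply/allP => x; rewrite (perm_mem tt'); exact: tA.
  have [t'' pt'' so''] : exists2 t'', perm_eq t'' (z :: t') & sorted forces t''.
    by case/orP: so => so; [exists (z :: t') | exists (rcons t' z); rewrite ?perm_rcons].
  have := tmax t''; rewrite /simple_path so'' (perm_uniq (perm_map _ pt'')) uz.
  rewrite (perm_all _ pt'') az (perm_size pt'') /= (perm_size tt') ltnn.
  by move/(_ isT).
have [n nE] : exists n, size t = n.+1 by exists (size t).-1; rewrite prednK.
have nlt : (n < size t)%N by rewrite nE.
have [w wA lw] := deg (y n).1 (y n).2 (TA _ (yT _ nlt)).
have [w' wA' fw'] := deg (y 0).1 (~~ (y 0).2) (TA _ (yT _ n0)).
have [p tp lp] : exists2 p, t = y 0 :: p & last (y 0) p = y n.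
  have -> : y n = last z0 t by rewrite -nth_last nE.
  by rewrite /y; case: (t) n0 => // x p _; exists p.
have srtp : path forces (y 0) p by move: srt; rewrite tp.
have wT : w \in T.
  apply: contraT => wT; case: (noext (w, ~~ (y n).2) t) => //.
  by apply/orP; right; rewrite tp /= rcons_path lp srtp /forces /= eqxx lw eqxx.
have wT' : w' \in T.
  apply: contraT => wT'; case: (noext (w', ~~ (y 0).2) t) => //.
  by apply/orP; left; rewrite tp /= srtp /forces /= negbK eqxx edge_colorC fw' eqxx.
have nthE x i : (i < size t)%N -> nth x t i = y i by move=> ?; exact: set_nth_default.
(* The only path edge at the last vertex has colour [~~ (y n).2], while the edge to [w] has colour
   [(y n).2]. *)
have wne i : (i.+1 < size t)%N -> [set (y i).1; (y i.+1).1] != [set (y n).1; w].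
  move=> si; apply/eqP => /set2_eq[[/yinj E _]|[wi /yinj E]].
    by have := E (ltnW si) nlt; lia.
  have {}E : i.+1 = n by exact: E.
  have /andP[/eqP y2 /eqP ec] := ysrt i si.
  by move: lw; rewrite -E edge_colorC -wi ec y2; case: (y i).2.
have wne' i : (i.+1 < size t)%N -> [set (y i).1; (y i.+1).1] != [set (y 0).1; w'].
  move=> si; apply/eqP => /set2_eq[[/yinj E wi]|[wi /yinj E]]; last first.
    by have := E si n0.
  have {}E : i = 0%N by apply: E => //; exact: ltnW.
  have /andP[/eqP y2 /eqP ec] := ysrt i si.
  by rewrite E in wi y2 ec; move: fw'; rewrite -wi ec; case: (y 0).2.
have bi a b : a \in T -> b \in T -> edge_color g a b != None ->
    [set (y n).1; w] != [set a; b] ->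
    (forall i, (i.+1 < size t)%N -> [set (y i).1; (y i.+1).1] != [set a; b]) ->
    exists t a b a' b', bicycle t a b a' b'.
  move=> aT bT ab neq cons; exists t, (y n).1, w, a, b; split=> //.
  - by split=> //; exact: yT.
  - by rewrite lw.
  - by move=> x i si; rewrite !nthE ?(ltnW si) //; split; [exact: wne|exact: cons].
have [E|] := eqVneq [set (y n).1; w] [set (y 0).1; w']; last first.
  by move=> h; apply: (bi (y 0).1 w') => //; [exact: yT | rewrite fw'].
have wn : w <> (y n).1 by move=> E'; rewrite E' edge_color_irr in lw.
(* The two extra edges coincide, so the path closes up into a cycle. Without
   chords it could be coloured by itself, so by minimality there is a chord
   or an edge leaving the cycle, and the latter would extend a rotation of
   the longest path. *)
have [{}E E'] : w = (y 0).1 /\ w' = (y n).1.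
  case/set2_eq: E => [[/yinj E _]|[-> ->] //].
  have [i si wi] := Ty _ wT; case: wn; rewrite wi; congr (y _).1.
  by have := E nlt n0; lia.
have close : forces (y n) (y 0).
  move: fw'; rewrite E' edge_colorC -E lw => -[].
  by rewrite /forces -E lw => ->; rewrite negbK !eqxx.
have cyc : cycle forces t by rewrite tp /= rcons_path lp close srtp.
have outside a b : a \in T -> b \in A -> b \notin T -> edge_color g a b = None.
  move=> aT bA bT; case ab: (edge_color g a b) => [k|//]; exfalso.
  have [[a1 ka] at' /= aE] := mapP aT; rewrite -aE in at'.
  have [i s' rs] := rot_to at'.
  have pr : perm_eq (rot i t) t by rewrite perm_rot.
  have cr : cycle forces (rot i t) by rewrite rot_cycle.
  rewrite rs in pr cr.
  (* The cycle is cut so that [a] becomes the last vertex if the edge to [b] has the colour of its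
     literal, and the first one otherwise; either way [b] prolongs the path. *)
  have [kka|kka] := eqVneq k ka.
    apply: (noext (b, ~~ ka) (rcons s' (a, ka))) => //.
      by rewrite perm_rcons.
    apply/orP; right; case: (s') cr => [|x p'] /=.
      by rewrite /forces /= eqxx ab kka eqxx.
    move=> /andP[_]; rewrite !rcons_path last_rcons => ->.
    by rewrite /forces /= eqxx ab kka eqxx.
  apply: (noext (b, ~~ ka) ((a, ka) :: s')) => //.
  apply/orP; left; rewrite /= {1}/forces /= negbK eqxx edge_colorC ab.
  rewrite [Some k == _](_ : _ = true) /=; last by case: (k) (ka) kka => [] [].
  by move: cr; rewrite /= rcons_path => /andP[].
pose chord a b := [&& a \in T, b \in T, edge_color g a b != None,
  [set (y n).1; w] != [set a; b] &
  all (fun i => [set (y i).1; (y i.+1).1] != [set a; b]) (iota 0 n)].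
have [/existsP[a /existsP[b /and5P[aT bT ab neq /allP cons]]]|nochord] :=
  boolP [exists a, exists b, chord a b].
  by apply: (bi a b) => // i si; apply: cons; rewrite mem_iota; rewrite nE in si.
case/negP: nA; have /colorable_onP[sigma0 h0] : colorable_on (A :\: [set u in T]).
  apply: colA; rewrite properE subsetDl /=; apply/negP => /subsetP/(_ _ (TA _ (yT _ n0))).
  by rewrite !inE yT.
apply/colorable_onP.
(* A vertex of the cycle gets the colour of its literal in [t]. These alternate around the cycle, so
   its edges are satisfied whatever their colours. *)
exists (fun u => if u \in T then (u, true) \in t else sigma0 u).
have lit i : (i < size t)%N -> (((y i).1, true) \in t) = (y i).2.
  move=> si; case y2: (y i).2.
    by rewrite -y2 -surjective_pairing mem_nth.
  apply/negP => yt; have := nth_index z0 yt; rewrite -/y => yj.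
  have ij : index ((y i).1, true) t = i by apply: yinj; rewrite ?index_mem // yj.
  by rewrite ij in yj; rewrite yj in y2.
move=> a b k aA bA ab.
have [aT|aT] := boolP (a \in T); have [bT|bT] := boolP (b \in T).
- have : ~~ chord a b by move/existsPn: nochord => /(_ a)/existsPn; apply.
  rewrite /chord aT bT ab /= negb_and negbK => cons.
  have [i [j [si sj yij eab]]] : exists i j, [/\ (i < size t)%N, (j < size t)%N,
      forces (y i) (y j) & [set (y i).1; (y j).1] = [set a; b]].
    case/orP: cons => [/eqP cons|/allPn[i]].
      by exists n, 0%N; split=> //; rewrite -E.
    rewrite mem_iota add0n negbK => /andP[_ si] /eqP cons; exists i, i.+1.
    have si' : (i.+1 < size t)%N by rewrite nE.
    by split=> //; [exact: ltnW | exact: ysrt].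
  have /andP[/eqP y2 _] := yij.
  have [[<- <-]|[<- <-]] := set2_eq eab; rewrite !lit // y2;
    by case: (y i).2 k {ab} => [] [].
- by rewrite outside in ab.
- by rewrite edge_colorC outside in ab.
- by apply: (h0 _ _ _ _ _ ab); rewrite !inE ?aT ?bT.
Qed.

End Bicycle.

(** * The expected number of bicycles *)

Section FirstMoment.
Variables (R : realType) (V : finType) (x0 : V).

(** Bicycles in a form that can be counted: a vertex sequence, the colour [c] of its first edge, and
    the positions of the four ends of the extra edges. *)
Definition bicycle_at N (t : N.-tuple V) (c : color) (e f : 'I_N * 'I_N) :
    pred (colored_graph V) := fun g =>
  [&& uniq t, e.1 != e.2, f.1 != f.2,
      [set tnth t e.1; tnth t e.2] != [set tnth t f.1; tnth t f.2],
      [forall m : 'I_N.-1,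
        ([set nth x0 t m; nth x0 t m.+1] != [set tnth t e.1; tnth t e.2])
        && ([set nth x0 t m; nth x0 t m.+1] != [set tnth t f.1; tnth t f.2])],
      [forall m : 'I_N.-1,
        edge_color g (nth x0 t m) (nth x0 t m.+1) == Some (c (+) odd m)],
      edge_color g (tnth t e.1) (tnth t e.2) != None
    & edge_color g (tnth t f.1) (tnth t f.2) != None].

Lemma pr_bicycle_at N (t : N.-tuple V) c e f (q : R) : 0 <= q -> 2 * q <= 1 ->
  pr (uniform_weights q) (bicycle_at t c e f) <= q ^+ N.-1 * (2 * q) ^+ 2.
Proof.
move=> q0 q1; have W1 := uniform_weights_stochastic (V := V) q0 q1.
have b0 : 0 <= q ^+ N.-1 * (2 * q) ^+ 2 by rewrite mulr_ge0 // exprn_ge0 // mulr_ge0.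
(* The conditions that do not depend on the graph come first; if they fail, the event is empty. *)
have [bad|] := boolP (~~ [&& uniq t, e.1 != e.2, f.1 != f.2,
      [set tnth t e.1; tnth t e.2] != [set tnth t f.1; tnth t f.2] &
      [forall m : 'I_N.-1,
        ([set nth x0 t m; nth x0 t m.+1] != [set tnth t e.1; tnth t e.2])
        && ([set nth x0 t m; nth x0 t m.+1] != [set tnth t f.1; tnth t f.2])]]).
  rewrite /pr big_pred0 // => g; apply: contraNF bad.
  by rewrite /bicycle_at => /and5P[-> -> -> -> /and4P[]].
rewrite negbK => /and5P[ut ee ff ef /forallP spare].
pose h (m : 'I_N.-1) := [set nth x0 t m; nth x0 t m.+1].
pose E := [set tnth t e.1; tnth t e.2]; pose F := [set tnth t f.1; tnth t f.2].
pose D0 := h @: [set: 'I_N.-1]; pose D := D0 :|: [set E; F].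
have mN (m : 'I_N.-1) : (m.+1 < N)%N by case: m => m /=; lia.
have hne (m : 'I_N.-1) : nth x0 t m != nth x0 t m.+1.
  apply: nth_neq; rewrite ?size_tuple ?mN ?neq_ltn ?ltnSn //.
  exact: ltnW (mN m).
have tne (i j : 'I_N) : i != j -> tnth t i != tnth t j.
  by move=> ij; rewrite !(tnth_nth x0); apply: nth_neq => //; rewrite size_tuple.
have D0P x : x \in D0 -> exists m, x = h m by case/imsetP => m _ ->; exists m.
have hinj : injective h.
  have inj a b : (a < N)%N -> (b < N)%N -> nth x0 t a = nth x0 t b -> a = b.
    by move=> ha hb /eqP; rewrite nth_uniq ?size_tuple // => /eqP.
  move=> m m' /set2_eq[[/inj i1 _]|[/inj i1 /inj i2]].
    by apply: val_inj; apply: i1; exact/ltnW/mN.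
  have m1 := i1 (ltnW (mN m)) (mN m').
  have m2 := i2 (mN m) (ltnW (mN m')).
  by move: m1 m2 => /=; lia.
pose P (x : {set V}) : pred (option color) := fun s =>
  (s != None) && [forall m, (x == h m) ==> (s == Some (c (+) odd m))].
apply: le_trans (pr_cylinder (D := D) (P := P) W1 _ _) _.
- move=> x; rewrite !inE => /or3P[/D0P[m ->]|/eqP->|/eqP->];
    by rewrite cards2 ?hne ?tne.
- move=> g /and5P[_ _ _ _ /and4P[_ /forallP path_ eE fF]] d dD.
  rewrite /P; apply/andP; split.
    move: dD; rewrite !inE => /or3P[/D0P[m dm]|/eqP de|/eqP df].
    + have [d' d'h gd'] := edge_color_val (hne m).
      have -> : d = d' by apply: val_inj; rewrite dm d'h.
      by rewrite -gd' (eqP (path_ m)).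
    + have [d' d'h gd'] := edge_color_val (tne _ _ ee).
      by have -> : d = d'; [apply: val_inj; rewrite de d'h | rewrite -gd'].
    + have [d' d'h gd'] := edge_color_val (tne _ _ ff).
      by have -> : d = d'; [apply: val_inj; rewrite df d'h | rewrite -gd'].
  apply/forallP => m; apply/implyP => /eqP dm.
  have [d' d'h gd'] := edge_color_val (hne m).
  have -> : d = d' by apply: val_inj; rewrite dm d'h.
  by rewrite -gd' path_.
have sum_le x : 0 <= \sum_(s | P x s) uniform_weights q x s <= 2 * q.
  rewrite big_mkcond sum_option_color /= add0r.
  by case: ifP => _; case: ifP => _; rewrite /uniform_weights; apply/andP; split; lra.
have dis : [disjoint D0 & [set E; F]].
  rewrite -setI_eq0; apply/eqP/setP => x; rewrite !inE; apply/negP.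
  move=> /andP[/D0P[m ->] /orP[]/eqP hm]; have /andP[] := spare m;
    by rewrite -/(h m) hm ?eqxx // => _; rewrite eqxx.
have -> : \prod_(x in D) \sum_(s | P x s) uniform_weights q x s =
    (\prod_(x in D0) \sum_(s | P x s) uniform_weights q x s) *
    \prod_(x in [set E; F]) \sum_(s | P x s) uniform_weights q x s.
  by rewrite -[RHS](bigU _ _ _ dis); apply: eq_bigl => x; rewrite in_setU.
apply: ler_pM.
- by apply: prodr_ge0 => x _; case/andP: (sum_le x).
- by apply: prodr_ge0 => x _; case/andP: (sum_le x).
- rewrite /D0 big_imset /=; last by move=> ? ? _ _; exact: hinj.
  rewrite -[X in q ^+ X]card_ord -cardsT -prodr_const; apply: ler_prod => m _.
  rewrite (proj1 (andP (sum_le _))) /=.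
  rewrite big_mkcond sum_option_color /= add0r.
  have PE k : P (h m) (Some k) -> k = c (+) odd m.
    by move=> /andP[_ /forallP/(_ m)]; rewrite eqxx /= => /eqP[].
  by case: ifP => [/PE r1|_]; case: ifP => [/PE r2|_];
    rewrite /uniform_weights ?addr0 ?add0r //; rewrite -r1 in r2.
rewrite big_setU1 ?inE //= big_set1 expr2.
by apply: ler_pM; case/andP: (sum_le E) => *;
  case/andP: (sum_le F) => *.
Qed.

Lemma sorted_forces_color (g : colored_graph V) (z : V * color) t : sorted (forces g) t ->
  forall i, (i < size t)%N -> (nth z t i).2 = (nth z t 0).2 (+) odd i.
Proof.
move=> /(sortedP z) st; elim=> [|i IH] si; first by rewrite addbF.
have /andP[/eqP -> _] := st i si; rewrite IH ?(ltnW si) //=.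
by rewrite addbN.
Qed.

(** Union bound over all bicycles. The factor 8 consists of 2 choices for the first colour and 4 for
    the colours of the extra edges. *)
Lemma pr_uncolorable_first_moment (q : R) : 0 <= q -> 2 * q <= 1 ->
  pr (uniform_weights q) [pred g | ~~ @adaptably_2_colorable V g] <=
  \sum_(N < #|V|.+1) (8 * N ^ 4 * #|V| ^ N)%:R * q ^+ N.-1 * q ^+ 2.
Proof.
move=> q0 q1; have W1 := uniform_weights_stochastic (V := V) q0 q1.
pose I (N : nat) : finType := (N.-tuple V * color * (('I_N * 'I_N) * ('I_N * 'I_N)))%type.
pose B (N : 'I_#|V|.+1) : pred (colored_graph V) := fun g =>
  [exists x : I N, bicycle_at x.1.1 x.1.2 x.2.1 x.2.2 g].
apply: le_trans (pr_union (B := B) W1 _) _; last first.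
  apply: ler_sum => N _.
  apply: le_trans (pr_union (I := I N)
    (B := fun x => bicycle_at x.1.1 x.1.2 x.2.1 x.2.2) W1 _) _ => //.
  apply: le_trans (_ : \sum_(x : I N) q ^+ N.-1 * (2 * q) ^+ 2 <= _).
    by apply: ler_sum => x _; exact: pr_bicycle_at.
  rewrite sumr_const !card_prod card_tuple card_bool !card_ord -[leLHS]mulr_natl.
  rewrite exprMn !natrM !natrX le_eqVlt; apply/orP; left; apply/eqP.
 ring.
move=> g _ /= /uncolorable_bicycle[t [a [b [a' [b' [srt ut]]]]]].
case=> aT bT aT' bT' [ab ab' nab] spare.
have tV : (size t < #|V|.+1)%N.
  by rewrite ltnS -(size_map fst) -(card_uniqP ut) max_card.
apply/existsP; exists (Ordinal tV); apply/existsP.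
have ix u : u \in [seq x.1 | x <- t] -> (index u [seq x.1 | x <- t] < size t)%N.
  by rewrite -index_mem size_map.
pose T := map_tuple fst (in_tuple t).
have tE u (uT : u \in [seq x.1 | x <- t]) : tnth T (Ordinal (ix u uT)) = u.
  by rewrite (tnth_nth x0) /= nth_index.
exists (T, (nth (x0, red) t 0).2, ((Ordinal (ix a aT), Ordinal (ix b bT)),
  (Ordinal (ix a' aT'), Ordinal (ix b' bT')))).
have ne u v (uT : u \in [seq x.1 | x <- t]) (vT : v \in [seq x.1 | x <- t]) :
    edge_color g u v != None -> Ordinal (ix u uT) != Ordinal (ix v vT).
  apply: contraNneq => /(congr1 (tnth T)); rewrite !tE => ->.
  by rewrite edge_color_irr.
have nthT i : (i < size t)%N -> nth x0 T i = (nth (x0, red) t i).1.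
  by move=> si; rewrite /= (nth_map (x0, red)).
have lt1 (m : 'I_(size t).-1) : (m.+1 < size t)%N by case: m => m /=; lia.
rewrite /bicycle_at /= -/T !tE ut !ne // nab ab ab' /= !andbT.
apply/andP; split; apply/forallP => m; rewrite !nthT ?lt1 ?(ltnW (lt1 m)) //.
  by have [-> ->] := spare (x0, red) m (lt1 m).
have := srt => /(sortedP (x0, red))/(_ m (lt1 m))/andP[_ /eqP ->].
by rewrite (sorted_forces_color _ srt) // ltnW ?lt1.
Qed.

End FirstMoment.

(** * Passing to the limit *)

Lemma whp_of_compl_le (R : realType) (T : nat -> finType)
    (mu : forall n, T n -> R) (A : forall n, pred (T n)) (C : R) (n0 : nat) :
  (forall n x, 0 <= mu n x) -> (forall n, prob (mu n) predT = 1) ->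
  (forall n, (n0 <= n)%N -> prob (mu n) (predC (A n)) <= C / n%:R) ->
  whp mu A.
Proof.
move=> mu0 mu1 bnd; rewrite /whp.
have split_ n : prob (mu n) (A n) = 1 - prob (mu n) (predC (A n)).
  apply: (@addIr _ (prob (mu n) (predC (A n)))); rewrite subrK -(mu1 n).
  by rewrite [RHS](bigID (A n)).
(* [harmonic n] is [1 / (n + 1)]; the factor 2 absorbs the shift. *)
have low : ((fun n => 1 - 2 * `|C| * @harmonic R n) @ \oo --> (1 : R))%classic.
  rewrite -[X in (_ --> X)%classic]subr0 -[X in 1 - X](mulr0 (2 * `|C|)).
  by apply: cvgB; [exact: cvg_cst | apply: cvgMr; exact: cvg_harmonic].
apply: (squeeze_cvgr _ low (cvg_cst (1 : R))).
exists n0.+1 => // n /= n0n; rewrite split_; apply/andP; split; last first.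
  by rewrite gerBl; apply: sumr_ge0.
rewrite lerD2l lerN2; apply: le_trans (bnd n (ltnW n0n)) _.
have n1 : 0 < n%:R :> R by rewrite ltr0n; apply: leq_trans n0n.
apply: le_trans (_ : `|C| / n%:R <= _).
  by rewrite ler_pM2r ?invr_gt0 // ler_norm.
rewrite [2 * _]mulrC -mulrA ler_wpM2l //= ler_pdivlMr ?ltr0n // mulrC.
rewrite ler_pdivrMr //; have : 1 <= n%:R :> R by rewrite ler1n -(ltr0n R).
by rewrite -natr1; lra.
Qed.

Lemma prob_random_colored_graph (R : realType) n (p : R) (A : pred (colored_graph 'I_n)) :
  prob (random_colored_graph p) A = pr (uniform_weights (clamp01 p / 2)) A.
Proof.
rewrite /prob /pr; apply: eq_bigr => g _; apply: eq_bigr => e _.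
rewrite /slot_weight /uniform_weights.
by case: (g e) => [_|] //; rewrite mulrCA divff ?mulr1 ?pnatr_eq0.
Qed.

(** * Estimates below and above the threshold *)

Lemma expRN_le (R : realType) (x : R) : 0 < x -> expR (- x) <= x^-1.
Proof.
move=> x0; rewrite expRN lef_pV2 ?posrE ?expR_gt0 //.
by apply: le_trans (expR_ge1Dx x); rewrite lerDr.
Qed.

(** With [8 * d = 1 - x] one has [N <= exp (d * N) / d] and [x <= exp (- 8 * d)], so the terms are
    dominated by a geometric series of ratio [exp (- 4 * d)]. *)
Lemma sum_pow4_geometric_bounded (R : realType) (x : R) : 0 <= x -> x < 1 ->
  exists C : R, forall n, \sum_(N < n) N%:R ^+ 4 * x ^+ N <= C.
Proof.
move=> x0 x1; pose d := (1 - x) / 8; have d0 : 0 < d by rewrite /d; lra.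
pose y := expR (- (4 * d)).
have y0 : 0 <= y by exact: expR_ge0.
have y1 : y < 1 by rewrite expR_lt1; lra.
exists (d^-1 ^+ 4 / (1 - y)) => n.
apply: le_trans (_ : \sum_(N < n) d^-1 ^+ 4 * y ^+ N <= _).
  apply: ler_sum => N _.
  have Nd : (N%:R : R) <= d^-1 * expR d ^+ N.
    rewrite -expRM_natl ler_pdivlMl // mulrC.
    by apply: le_trans (expR_ge1Dx _); rewrite lerDr.
  have xe : x <= expR (- (8 * d)).
    by apply: le_trans (expR_ge1Dx _); rewrite /d; lra.
  have -> : d^-1 ^+ 4 * y ^+ N = (d^-1 * expR d ^+ N) ^+ 4 * expR (- (8 * d)) ^+ N.
    have e4 : (expR d ^+ N) ^+ 4 = (expR d ^+ 4) ^+ N by rewrite -!exprM mulnC.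
    rewrite exprMn e4 -[RHS]mulrA -[X in _ = _ * X]exprMn -expRM_natl -expRD.
    congr (_ * expR _ ^+ _).
    by lra.
  by apply: ler_pM; rewrite ?exprn_ge0 ?lerXn2r ?nnegrE ?expR_ge0 ?mulr_ge0
    ?invr_ge0 ?exprn_ge0 ?expR_ge0 ?(ltW d0).
rewrite -mulr_sumr ler_wpM2l ?exprn_ge0 ?invr_ge0 ?(ltW d0) //.
rewrite -[leRHS]mul1r ler_pdivlMr ?subr_gt0 // mulrC -opprB mulNr -subrX1 opprB gerBl.
exact: exprn_ge0.
Qed.

(** The excess edge of a bicycle yields the decay: [n ^ N * q ^ (N + 1)] is [(n * q) ^ (N + 1) / n],
    and the sum over [N] stays bounded for [n * q <= x]. *)
Lemma pr_uncolorable_subcritical (R : realType) (x : R) : 0 <= x -> x < 1 ->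
  exists C : R, forall (V : finType) (q : R), (0 < #|V|)%N ->
    0 <= q -> q <= x / #|V|%:R -> 2 * q <= 1 ->
  pr (uniform_weights q) [pred g | ~~ @adaptably_2_colorable V g] <= C / #|V|%:R.
Proof.
move=> x0 x1; have [C bC] := sum_pow4_geometric_bounded x0 x1.
exists (8 * C) => V q V0 q0 qx q1.
have [v _] := card_gt0P V0.
apply: le_trans (pr_uncolorable_first_moment v q0 q1) _.
have n0 : 0 < #|V|%:R :> R by rewrite ltr0n.
rewrite [leRHS]mulrAC.
apply: le_trans (_ : 8 / #|V|%:R * \sum_(N < #|V|.+1) N%:R ^+ 4 * x ^+ N <= _);
  last by rewrite ler_wpM2l ?bC // divr_ge0 // ltW.
rewrite mulr_sumr; apply: ler_sum => -[[|N] hN] _ /=.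
  by rewrite exp0n // muln0 mul0n expr0n /= !(mul0r, mulr0).
rewrite !natrM !natrX.
have nq : #|V|%:R * q <= x by rewrite mulrC -ler_pdivlMr.
have -> : 8 * N.+1%:R ^+ 4 * #|V|%:R ^+ N.+1 * q ^+ N * q ^+ 2 =
    8 / #|V|%:R * (N.+1%:R ^+ 4 * (#|V|%:R * q) ^+ N.+2).
  rewrite exprMn !exprS; field; exact: lt0r_neq0.
rewrite ler_wpM2l ?divr_ge0 ?(ltW n0) // ler_wpM2l ?exprn_ge0 //.
apply: le_trans (_ : x ^+ N.+2 <= _).
  by rewrite lerXn2r // nnegrE // mulr_ge0 // ltW.
by rewrite exprS ler_piMl ?exprn_ge0 // ltW.
Qed.

(** For [z = 1 - 1 / k] the two bases are [1 - q1 / k] and [1 + 1 / (k - 1)]; both are bounded by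
    [1 + u <= exp u]. *)
Lemma search_bound_le_expR (R : realType) (q1 k : R) M S : 0 <= q1 -> q1 <= 1 ->
  1 < k -> search_bound q1 (1 - k^-1) M S 0 0 <=
    expR (S%:R / (k - 1) - q1 * M%:R / k).
Proof.
move=> q10 q11 k1; have k0 : 0 < k by lra.
have ki0 : 0 < k^-1 by rewrite invr_gt0.
have ki1 : k^-1 < 1 by rewrite invf_lt1.
rewrite /search_bound !expr0 !mul1r (_ : 1 - (1 - k^-1) = k^-1); last by ring.
rewrite [X in expR X]addrC expRD; apply: ler_pM.
- by apply: exprn_ge0; rewrite subr_ge0 mulr_ile1 // ltW.
- by apply: exprn_ge0; rewrite invr_ge0 subr_ge0 ltW.
- have -> : - (q1 * M%:R / k) = M%:R * (- (q1 / k)) by ring.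
  rewrite expRM_natl lerXn2r ?nnegrE ?expR_ge0 ?expR_ge1Dx //.
  by rewrite subr_ge0 mulr_ile1 // ltW.
rewrite expRM_natl lerXn2r ?nnegrE ?expR_ge0 ?invr_ge0 ?subr_ge0 ?(ltW ki1) //.
have -> : (1 - k^-1)^-1 = 1 + (k - 1)^-1; last exact: expR_ge1Dx.
by field; rewrite !lt0r_neq0 //; lra.
Qed.

(* The DFS stops after finishing [m = 8 K t] vertices or with a path on [8 t]
   vertices, where [t] is a small constant fraction of the number of vertices. *)
Lemma pr_colorable_supercritical (R : realType) (x : R) : 1 < x ->
  exists (C : R) (n0 : nat), forall V : finType, (n0 <= #|V|)%N ->
  pr (uniform_weights (x / #|V|%:R)) (@adaptably_2_colorable V) <= C / #|V|%:R.
Proof.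
(* [x' / n] is the probability of a positive answer, still above [1 / n], and [d / n] is what is
   left over for each colour. *)
move=> x1; pose x' := (1 + x) / 2; pose d := (x - 1) / 2.
have x'1 : 1 < x' by rewrite /x'; lra.
have d0 : 0 < d by rewrite /d; lra.
have [K K0 hK] : exists2 K, (0 < K)%N & (2 * x' + 1) / (x' - 1) < K%:R.
  exists (Num.bound ((2 * x' + 1) / (x' - 1))).+1 => //.
  apply: lt_trans (archi_boundP _) _; first by rewrite divr_ge0 //; lra.
  by rewrite ltr_nat.
pose k : R := K%:R; rewrite -/k in hK.
have kx : 2 * x' + 1 < k * (x' - 1) by rewrite -ltr_pdivrMr //; lra.
have k2 : 2 < k by nra.
(* [8 * t * c] bounds from below the decay exponent of [search_bound]; a large [K] makes [c]
   positive since [x' > 1]. *)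
pose c := x' * (1 - k^-1) - (1 + k^-1) / (1 - k^-1).
have c0 : 0 < c.
  have ki0 : 0 < k^-1 by rewrite invr_gt0; lra.
  have ki2 : k^-1 < 2^-1 by rewrite ltf_pV2 ?posrE; lra.
  rewrite /c subr_gt0 ltr_pdivrMr; last by lra.
  have : (2 * x' + 1) * k^-1 < x' - 1.
    by rewrite ltr_pdivrMr; lra.
  have : 0 <= x' * (k^-1 * k^-1) by rewrite !mulr_ge0 //; lra.
  by move: (k^-1) => u; lra.
(* For [t = n %/ D] the search visits at most [8 * (K + 1) * t] vertices, a fraction of at most
   [1 / K]. *)
have [D DE] : {D | D = (8 * K.+1 * K)%N} by exists (8 * K.+1 * K)%N.
have D_gt0 : (0 < D)%N by rewrite DE !muln_gt0 K0.
have D0 : 0 < D%:R :> R by rewrite ltr0n.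
exists (D%:R / (4 * c) + 8 * D%:R ^+ 2 / d), (maxn (D * 2) (Num.bound (2 * x))) => V.
rewrite geq_max => /andP[nD nx].
have [v _] : exists v, v \in V.
  by apply/card_gt0P; apply: leq_trans nD; rewrite muln_gt0 D_gt0.
have [n nV] : {n | n = #|V|} by exists #|V|.
rewrite -nV in nD nx *; pose t := (n %/ D)%N.
have tD : (t * D <= n)%N by exact: leq_trunc_div.
have t2 : (n <= 2 * t * D)%N.
  have t1 : (1 <= t)%N by rewrite divn_gt0 //; apply: leq_trans nD; rewrite leq_pmulr.
  apply: leq_trans (ltnW (ltn_ceil n D_gt0)) _; rewrite -/t leq_mul2r mul2n -addnn.
  by rewrite -addn1 leq_add2l t1 orbT.
have x2n : 2 * x <= n%:R.
  apply: le_trans (ltW (archi_boundP _)) _; first by lra.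
  by rewrite ler_nat.
have n0 : 0 < n%:R :> R by lra.
have S_le : ((8 * K * t + t * 8) * K <= n)%N.
  by apply: leq_trans tD; rewrite DE; move: (K) => j; lia.
have S_le' : (8 * K * t + t * 8 <= n)%N.
  by apply: leq_trans S_le; rewrite leq_pmulr.
have x'n : x' / n%:R <= x / n%:R by rewrite ler_pM2r ?invr_gt0 // /x'; lra.
have xn : 2 * (x / n%:R) <= 1 by rewrite mulrA ler_pdivrMr // mul1r.
have x'0 : 0 <= x' / n%:R by rewrite divr_ge0 //; lra.
have ki0 : 0 < k^-1 by rewrite invr_gt0; lra.
have ki1 : k^-1 < 1 by rewrite invf_lt1; lra.
have mr : (8 * K * t + t * 8 <= #|V|)%N by rewrite -nV.
have z0 : 0 < 1 - k^-1 by lra.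
have z1 : 1 - k^-1 <= 1 by lra.
apply: le_trans (pr_colorable_search x'0 x'n xn z0 z1 mr
  (search_state_init v x'0 xn x'n) _ _) _; rewrite ?cards0 //.
rewrite -nV mulrDl; apply: lerD.
  have k1 : 1 < k by lra.
  have q11 : x' / n%:R <= 1 by lra.
  apply: le_trans (search_bound_le_expR _ _ x'0 q11 k1) _.
  apply: le_trans (_ : expR (- (4 * c / D%:R * n%:R)) <= _).
    rewrite ler_expR natrM natrB // !natrD !natrM -/k.
    have tn : n%:R <= 2 * t%:R * D%:R :> R by rewrite -!natrM ler_nat.
    have St : (8 * k * t%:R + t%:R * 8) / n%:R <= k^-1.
      rewrite ler_pdivrMr // [leRHS]mulrC ler_pdivlMr; last by lra.
      by rewrite -!natrM -natrD -natrM ler_nat.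
    have Sk : (8 * k * t%:R + t%:R * 8) / (k - 1) =
        8 * t%:R * ((1 + k^-1) / (1 - k^-1)).
      by field; rewrite !lt0r_neq0 //; lra.
    have Mk : x' / n%:R * (8 * k * t%:R * (n%:R - (8 * k * t%:R + t%:R * 8))) / k =
        8 * t%:R * (x' * (1 - (8 * k * t%:R + t%:R * 8) / n%:R)).
      by field; rewrite !lt0r_neq0 //; lra.
    rewrite Sk Mk.
    apply: le_trans (_ : - (8 * t%:R * c) <= _).
      have key : 8 * t%:R * (x' * (1 - k^-1)) <=
          8 * t%:R * (x' * (1 - (8 * k * t%:R + t%:R * 8) / n%:R)).
        by apply: ler_wpM2l; rewrite ?mulr_ge0 //; apply: ler_wpM2l; lra.
      by rewrite /c mulrBr; move: key; move: (_ / (1 - k^-1)) => e; lra.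
    rewrite lerN2 [leLHS](_ : _ = 4 * c * n%:R / D%:R); last by ring.
    by rewrite ler_pdivrMr //; have := ler_wpM2l (ltW c0) tn; lra.
  apply: le_trans (expRN_le _) _; first by rewrite !mulr_gt0 ?invr_gt0.
  rewrite le_eqVlt; apply/orP; left; apply/eqP; field.
  by rewrite !lt0r_neq0.
have -> : x / n%:R - x' / n%:R = d / n%:R by rewrite /x' /d; field; exact: lt0r_neq0.
(* There are [t * t] pairs with [t >= n / (2 * D)], each present with probability at least
   [d / n]. *)
apply: le_trans (_ : expR (- (d / (4 * D%:R ^+ 2) * n%:R)) *+ 2 <= _).
  rewrite lerMn2r /=; apply: le_trans (_ : expR (- (d / n%:R)) ^+ (t * t) <= _).
    apply: lerXn2r; rewrite ?nnegrE ?expR_ge0 ?expR_ge1Dx //.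
    by rewrite subr_ge0 ler_pdivrMr // mul1r /d; lra.
  rewrite -expRM_natl ler_expR mulrN lerN2.
  have tn : n%:R / (2 * D%:R) <= t%:R :> R.
    by rewrite ler_pdivrMr ?mulr_gt0 // mulrA [t%:R * 2]mulrC -!natrM ler_nat.
  have tn0 : 0 <= n%:R / (2 * D%:R) :> R by rewrite divr_ge0 ?mulr_ge0 // ltW.
  rewrite natrM.
  apply: le_trans (_ : n%:R / (2 * D%:R) * (n%:R / (2 * D%:R)) * (d / n%:R) <= _).
    rewrite le_eqVlt; apply/orP; left; apply/eqP; field.
    by rewrite !lt0r_neq0.
  by apply: ler_wpM2r; [rewrite divr_ge0 // ltW | exact: ler_pM].
apply: le_trans (_ : (d / (4 * D%:R ^+ 2) * n%:R)^-1 *+ 2 <= _).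
  by rewrite lerMn2r /= expRN_le // mulr_gt0 // divr_gt0 // mulr_gt0 // exprn_gt0.
rewrite le_eqVlt; apply/orP; left; apply/eqP; field.
by rewrite !lt0r_neq0.
Qed.

(** * Both sides of the threshold *)

Theorem theorem1p3 (R : realType) (eps : R) (heps : 0 < eps) :
  whp (fun n => @random_colored_graph R n ((2 - eps) / n%:R))
      (fun n g => adaptably_2_colorable g)
  /\
  whp (fun n => @random_colored_graph R n ((2 + eps) / n%:R))
      (fun n g => ~~ adaptably_2_colorable g).
Proof.
split.
  (* The maximum with 0 matches the clamping of the edge probability when [eps > 2]. *)
  pose x := Num.max 0 (1 - eps / 2).
  have x0 : 0 <= x by rewrite le_max lexx.
  have xe : 1 - eps / 2 <= x by rewrite le_max lexx orbT.
  have x1 : x < 1 by rewrite gt_max ltr01 /=; lra.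
  have [C bC] := pr_uncolorable_subcritical x0 x1.
  apply: (@whp_of_compl_le _ _ _ _ C 1%N) => [n g|n|n n1].
  - exact: random_colored_graph_ge0.
  - exact: random_colored_graph_sum1.
  have n0 : 0 < n%:R :> R by rewrite ltr0n.
  rewrite prob_random_colored_graph -[in leRHS](card_ord n).
  have c0 := clamp01_ge0 ((2 - eps) / n%:R).
  have c1 := clamp01_le1 ((2 - eps) / n%:R).
  apply: bC; rewrite ?card_ord //; [by lra| |by lra].
  rewrite ler_pdivrMr // /clamp01 ge_max; apply/andP; split.
    by rewrite mulr_ge0 // divr_ge0 // ltW.
  apply: le_trans (_ : (2 - eps) / n%:R <= _); first by rewrite ge_min lexx.
  by rewrite [leRHS]mulrAC ler_pM2r ?invr_gt0 //; lra.
have x1 : 1 < 1 + eps / 2 by lra.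
have [C [n0 bC]] := pr_colorable_supercritical x1.
(* From the second bound on, [(2 + eps) / n] is at most 1 and clamping has no effect. *)
pose n1 := maxn n0 (Num.bound (2 + eps)).
apply: (@whp_of_compl_le _ _ _ _ C n1) => [n g|n|n].
- exact: random_colored_graph_ge0.
- exact: random_colored_graph_sum1.
rewrite geq_max => /andP[nn0 nb].
have ne : 2 + eps <= n%:R.
  apply: le_trans (ltW (archi_boundP _)) _; first by lra.
  by rewrite ler_nat.
have np : 0 < n%:R :> R by lra.
rewrite prob_random_colored_graph clamp01_id; last first.
  by rewrite divr_ge0 ?ler_pdivrMr ?mul1r //; lra.
have -> : (2 + eps) / n%:R / 2 = (1 + eps / 2) / n%:R :> R.
  by field; rewrite lt0r_neq0.
have := bC 'I_n; rewrite card_ord => /(_ nn0); apply: le_trans.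
rewrite /pr le_eqVlt; apply/orP; left; apply/eqP.
by apply: eq_bigl => g /=; rewrite negbK.
Qed.
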